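(* The function $d_0$ is a metric on $C(S^1,S^1)$, and there exists a homeomorphism $\phi: C(S^1,S^1)\to \widehat{C}(I,\mathbb{R})$ (where $C(S^1,S^1)$ carries the topology induced by $d_0$ and $\widehat{C}(I,\mathbb{R})$ the topology induced by $d_1$) such that $d_0(f,g)=2\pi\, d_1(\phi(f),\phi(g))$ for all $f,g\in C(S^1,S^1)$.
   Context: $S^1=\{(x,y)\in\mathbb{R}^2: x^2+y^2=1\}$, $I=[0,1]$, and $C(S^1,S^1)$ is the set of all continuous functions from $S^1$ to $S^1$. Let $\widehat{C}(I,\mathbb{R})=\{f:I\to\mathbb{R} \text{ continuous} : f(0)\in[0,1),\ f(1)-f(0)\in\mathbb{Z}\}$, equipped with the metric $d_1(f,g)=\sup_{t\in I}|f(t)-g(t)|$. Let $\alpha:[0,1]\to S^1$, $\alpha(t)=(\cos 2\pi t,\sin 2\pi t)$, and let $p:\mathbb{R}\to S^1$, $p(t)=(\cos 2\pi t,\sin 2\pi t)$, be the covering map. For $f\in C(S^1,S^1)$, let $\tilde{f_\alpha}:I\to\mathbb{R}$ be the unique continuous map with $p\circ\tilde{f_\alpha}=f\circ\alpha$ and $\tilde{f_\alpha}(0)\in[0,1)$; then $\tilde{f_\alpha}\in\widehat{C}(I,\mathbb{R})$. For $x\in S^1$, $x\neq(1,0)$, $\alpha^{-1}(x)$ denotes the unique $t\in(0,1)$ with $\alpha(t)=x$. For $f,g\in C(S^1,S^1)$ define $$d_0(f,g)=2\pi\sup_{x\in S^1,\ x\neq(1,0)}\left|\tilde{f_\alpha}(\alpha^{-1}(x))-\tilde{g_\alpha}(\alpha^{-1}(x))\right|.$$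 *)

(* Defs.v *)
From mathcomp Require Import all_boot all_order all_algebra.
From mathcomp Require Import all_classical all_reals all_analysis.
From HB Require Import structures.
Import Order.TTheory GRing.Theory Num.Theory.
Import numFieldNormedType.Exports.

Set Implicit Arguments.
Unset Strict Implicit.
Unset Printing Implicit Defensive.

Local Open Scope classical_set_scope.
Local Open Scope ring_scope.

Definition is_metric (R : realType) (T : Type) (d : T -> T -> R) : Prop :=
  [/\ forall x y, 0 <= d x y,
      forall x y, d x y = 0 <-> x = y,
      forall x y, d x y = d y x
    & forall x y z, d x z <= d x y + d y z].

(* The type [T] with the metric [d] and the topology it induces. The synonym
   keeps this topology apart from any other one that [T] carries. *)
Definition metric_space (R : realType) (T : Type) (d : T -> T -> R)
  (hd : is_metric d) : Type := T.

Section MetricSpace.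
Context (R : realType) (T : choiceType) (d : T -> T -> R).
Context (hd : is_metric d).

Let dxx x : d x x = 0. Proof. by case: hd => _ /(_ x x) [_ ->]. Qed.
Let dpos x y : d x y = 0 -> x = y. Proof. by case: hd => _ /(_ x y) []. Qed.
Let dsym x y : d x y = d y x. Proof. by case: hd. Qed.
Let dtri y x z : d x z <= d x y + d y z. Proof. by case: hd. Qed.

HB.instance Definition _ := Choice.copy (metric_space hd) T.
HB.instance Definition _ :=
  @isMetric.Build R (metric_space hd) d dxx dpos dsym dtri.
End MetricSpace.

Definition homeomorphism (X Y : topologicalType) (f : X -> Y) : Prop :=
  continuous f /\
  exists g : Y -> X, [/\ continuous g, cancel f g & cancel g f].

(* [I01 R] and [S1 R] are sets coerced to types, with the topology induced from
   [R] and [R * R]. *)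
Definition I01 (R : realType) : set R := `[0, 1]%classic.
Arguments I01 R : clear implicits.

Lemma zeroI_subproof (R : realType) : (0 : R) \in I01 R.
Proof. by apply/mem_set; rewrite /I01 /= in_itv /= lexx ler01. Qed.

Lemma oneI_subproof (R : realType) : (1 : R) \in I01 R.
Proof. by apply/mem_set; rewrite /I01 /= in_itv /= lexx ler01. Qed.

Definition zeroI (R : realType) : I01 R := exist _ 0 (zeroI_subproof R).
Definition oneI (R : realType) : I01 R := exist _ 1 (oneI_subproof R).

Definition S1 (R : realType) : set (R * R) :=
  [set z | z.1 ^+ 2 + z.2 ^+ 2 = 1].
Arguments S1 R : clear implicits.

Lemma S1_cover_subproof (R : realType) (t : R) :
  (cos (2 * pi * t), sin (2 * pi * t)) \in S1 R.
Proof. by apply/mem_set; exact: cos2Dsin2. Qed.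

Definition S1_cover (R : realType) (t : R) : S1 R :=
  exist _ (cos (2 * pi * t), sin (2 * pi * t)) (S1_cover_subproof t).

Definition alpha (R : realType) (t : I01 R) : S1 R := S1_cover (\val t).

Definition C_S1 (R : realType) : Type := continuousType (S1 R) (S1 R).
HB.instance Definition _ (R : realType) := Choice.on (C_S1 R).

Record Chat (R : realType) : Type := MkChat {
  Chat_fun :> continuousType (I01 R) R ;
  Chat_fun0 : 0 <= Chat_fun (zeroI R) < 1 ;
  Chat_fun1 : Chat_fun (oneI R) - Chat_fun (zeroI R) \is a Num.int
}.

HB.instance Definition _ (R : realType) := gen_eqMixin (Chat R).
HB.instance Definition _ (R : realType) := gen_choiceMixin (Chat R).

Definition d1 (R : realType) (f g : Chat R) : R :=
  sup (range (fun t : I01 R => `|f t - g t|)).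

(* In both definitions the set is a singleton for every relevant argument
   ([\val x <> (1, 0)] for [alpha_inv]). The values [cst 0] and [zeroI R]
   are the defaults of [xget], returned only where the set is empty. *)
Definition lift_alpha (R : realType) (f : C_S1 R) : continuousType (I01 R) R :=
  xget (cst 0 : continuousType (I01 R) R)
    [set h : continuousType (I01 R) R |
      @S1_cover R \o h = f \o @alpha R /\ 0 <= h (zeroI R) < 1].

Definition alpha_inv (R : realType) (x : S1 R) : I01 R :=
  xget (zeroI R) [set t : I01 R | 0 < \val t < 1 /\ alpha t = x].

Definition d0 (R : realType) (f g : C_S1 R) : R :=
  2 * pi *
  sup [set `|lift_alpha f (alpha_inv x) - lift_alpha g (alpha_inv x)|
      | x in [set x : S1 R | \val x <> (1, 0)]].

Lemma Chat_ext (R : realType) (f g : Chat R) : (forall t, f t = g t) -> f = g.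
Proof.
case: f g => [f f0 f1] [g g0 g1] /= /continuousEP fg.
by move: f0 f1; rewrite fg => f0 f1; congr MkChat; exact: Prop_irrelevance.
Qed.

Lemma d1_has_sup (R : realType) (f g : Chat R) :
  has_sup (range (fun t : I01 R => `|f t - g t|)).
Proof.
split; first by exists `|f (zeroI R) - g (zeroI R)|, (zeroI R).
have ch : continuous (fun t : I01 R => `|f t - g t| : R).
  move=> t; have FF : Filter (nbhs t) := @nbhs_filter (set_type (I01 R)) t.
  by apply: cvg_norm; apply: cvgB; exact: cts_fun.
set h := fun t : I01 R => _ in ch *.
have /(EVT_max ler01)[c _ hc] :=
  (subspace_valL_continuousP' (I01 R) (0 : R) h).2 ch.
exists ('valL_(0 : R) h c) => _ [t _ <-].
have tI : \val t \in `[0, 1] by exact: (set_mem (valP t)).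
rewrite (le_trans _ (hc _ tI))// -[X in X <= _]/(h t).
by rewrite -[in X in X <= _](valLK (0 : R) h).
Qed.

Lemma d1_ge (R : realType) (f g : Chat R) (t : I01 R) : `|f t - g t| <= d1 f g.
Proof. by apply: ub_le_sup; [exact: (d1_has_sup f g).2|exists t]. Qed.

Lemma d1_le (R : realType) (f g : Chat R) (M : R) :
  (forall t, `|f t - g t| <= M) -> d1 f g <= M.
Proof.
move=> h; apply: ge_sup; first exact: (d1_has_sup f g).1.
by move=> _ [t _ <-].
Qed.

Lemma d1_metric (R : realType) : is_metric (@d1 R).
Proof.
have ge0 x y : 0 <= @d1 R x y.
  exact: le_trans (normr_ge0 _) (d1_ge x y (zeroI R)).
split=> //.
- move=> f g; split=> [fg0|->].
    apply: Chat_ext => t; apply/eqP.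
    rewrite -subr_eq0 -normr_le0 -[X in _ <= X]fg0; exact: d1_ge.
  apply/eqP; rewrite eq_le ge0 andbT; apply: d1_le => t.
  by rewrite subrr normr0.
- have dC f g : @d1 R f g <= d1 g f.
    by apply: d1_le => t; rewrite distrC d1_ge.
  by move=> f g; apply/eqP; rewrite eq_le !dC.
- move=> f g h; apply: d1_le => t.
  by rewrite (le_trans (ler_distD (g t) _ _))// lerD// d1_ge.
Qed.

(* Main.v *)
(* The map f |-> lift_alpha f is a bijection from C(S^1,S^1) to Chat, and d0 is
   2 pi times the pullback of d1 along it; that d0 is a metric and that this
   bijection is a homeomorphism follow formally.
   Lifts exist because a path g in S^1 is, for n large, g(0) times the product
   of the increments g(t (i + 1) / n) / g(t i / n), i < n, all of which have
   positive real part and hence an argument, given by arcsine, that is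
   continuous in t. Two lifts with initial value in [0, 1[ differ by a
   continuous integer-valued function that vanishes at 0. A path with equal
   endpoints descends along alpha, because alpha is a closed map. The supremum
   defining d0 runs over ]0, 1[ only, which by continuity is the same as the
   supremum over [0, 1]. *)
From HB Require Import structures.
Require Import Defs.
From mathcomp Require Import all_boot all_order all_algebra.
From mathcomp Require Import all_classical all_reals all_analysis.
From mathcomp Require Import ring lra.
Import Order.TTheory GRing.Theory Num.Theory.
Import numFieldNormedType.Exports.

Set Implicit Arguments.
Unset Strict Implicit.
Unset Printing Implicit Defensive.

Local Open Scope classical_set_scope.
Local Open Scope ring_scope.

(** * Fibres and surjectivity of the covering map *)

Lemma trig_period (R : realType) (t z : R) : z \is a Num.int ->
  cos (2 * pi * (t + z)) = cos (2 * pi * t) /\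
  sin (2 * pi * (t + z)) = sin (2 * pi * t).
Proof.
move=> /intrP[m ->].
have nat_case (n : nat) (s : R) :
    cos (2 * pi * (s + n%:R)) = cos (2 * pi * s) /\
    sin (2 * pi * (s + n%:R)) = sin (2 * pi * s).
  have -> : 2 * pi * (s + n%:R) = 2 * pi * s + (pi *+ 2) *+ n.
    by rewrite -[in RHS](mulr_natl _ n) -(mulr_natl pi 2); ring.
  by rewrite (periodicn (@cosD2pi R)) (periodicn (@sinD2pi R)).
case: m => n; first by rewrite -pmulrn; exact: nat_case.
(* A negative shift of [t] is a positive shift of the point [t - n.+1%:R], read backwards. *)
have := nat_case n.+1 (t - n.+1%:R); rewrite subrK NegzE mulrNz.
by case=> -> ->.
Qed.

Lemma floor_frac_itv (R : realType) (t : R) :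
  0 <= t - (Num.floor t)%:~R < 1.
Proof.
have /andP[] := floor_itv t; rewrite subr_ge0 intrD => -> ?; lra.
Qed.

(** For the direct implication, let [u] be the fractional part of [s - t]. Then
    [cos (2 * pi * u) = 1], so [sin (pi * u) = 0] by the double-angle formula, while the sine is
    positive on ]0, pi[; hence [u = 0]. *)
Lemma S1_coverP (R : realType) (s t : R) :
  S1_cover s = S1_cover t <-> s - t \is a Num.int.
Proof.
split=> [|st]; last first.
  apply: val_inj => /=; have [] := trig_period t st.
  by rewrite subrKC => -> ->.
move=> /(congr1 \val) /= [cE sE].
have fe : s - t = (s - t - (Num.floor (s - t))%:~R) + (Num.floor (s - t))%:~R.
  by rewrite subrK.
set u := s - t - _ in fe.
have u01 : 0 <= u < 1 := floor_frac_itv (s - t).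
have cu : cos (2 * pi * u) = 1.
  have [] := @trig_period R u (Num.floor (s - t))%:~R (intr_int _ _).
  rewrite -fe => <- _.
  have -> : 2 * pi * (s - t) = 2 * pi * s - 2 * pi * t by ring.
  by rewrite cosB cE sE -!expr2 cos2Dsin2.
have [u0|u0] := eqVneq u 0.
  by rewrite fe u0 add0r intr_int.
have : 0 < sin (pi * u).
  apply: sin_gt0_pi; rewrite pmulr_rgt0 ?pi_gt0// lt_neqAle eq_sym u0/=.
  by case/andP: u01 => -> u1 /=; rewrite -[ltRHS]mulr1 ltr_pM2l ?pi_gt0.
move: cu; have -> : 2 * pi * u = (pi * u) *+ 2 by rewrite -[RHS]mulr_natl mulrA.
rewrite cos_mulr2n cos2sin2 mulrnBl => ? ?.
suff : sin (pi * u) ^+ 2 = 0 by move/eqP; rewrite sqrf_eq0; lra.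
lra.
Qed.

(** The arccosine of the first coordinate is the angle up to sign, and the sign of the second
    coordinate decides. Subtracting the floor brings the parameter into [0, 1[. *)
Lemma S1_cover_surj (R : realType) (z : S1 R) :
  exists2 t : R, 0 <= t < 1 & S1_cover t = z.
Proof.
suff [t tz] : exists t : R, S1_cover t = z.
  exists (t - (Num.floor t)%:~R).
    exact: floor_frac_itv.
  rewrite -tz; apply/S1_coverP.
  by rewrite addrAC subrr add0r rpredN intr_int.
have zS : (\val z).1 ^+ 2 + (\val z).2 ^+ 2 = 1 := set_mem (valP z).
set x := (\val z).1 in zS; set y := (\val z).2 in zS.
have x1 : -1 <= x <= 1.
  have := sqr_ge0 y; rewrite -ler_norml => ?.
  by rewrite -(@expr_le1 _ 2)// real_normK ?num_real//; lra.
have sE : sin (acos x) = `|y|.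
  by rewrite sin_acos// -zS addrAC subrr add0r sqrtr_sqr.
have mulK a : 2 * pi * (a / (2 * pi)) = a :> R.
  by rewrite mulrC divfK// mulf_neq0 ?pnatr_eq0// gt_eqF ?pi_gt0.
have xa : cos (acos x) = x by rewrite acosK// in_itv.
have [y0|y0] := leP 0 y.
  exists (acos x / (2 * pi)); apply: val_inj => /=.
  by rewrite mulK sE xa ger0_norm// -surjective_pairing.
exists (- acos x / (2 * pi)); apply: val_inj => /=.
by rewrite mulK cosN sinN sE xa ltr0_norm// opprK -surjective_pairing.
Qed.

(** * Existence and uniqueness of lifts of paths *)

(** The expression is the real part of the increment from [a] to [b]. It equals 1 on the diagonal,
    so it is positive near each diagonal point, and compactness of [0, 1] makes the neighbourhood
    uniform. *)
Lemma circle_path_subdivision (R : realType) (X Y : R -> R) :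
  continuous X -> continuous Y -> (forall t, X t ^+ 2 + Y t ^+ 2 = 1) ->
  exists n : nat, forall a b : R, 0 <= a <= 1 -> `|a - b| <= n.+1%:R^-1 ->
    0 < X a * X b + Y a * Y b.
Proof.
move=> cX cY XY.
have := @segment_compact R 0 1; rewrite compact_near_coveringP.
move=> /(_ nat \oo (fun n a => forall b : R, `|a - b| <= n.+1%:R^-1 ->
    0 < X a * X b + Y a * Y b)) [].
  move=> c c01.
  pose phi (p : R * R) := X p.1 * X p.2 + Y p.1 * Y p.2.
  have cphi : phi p @[p --> (c, c)] --> phi (c, c).
    apply: cvgD; apply: cvgM.
    - by apply: (cvg_comp _ _ cvg_fst); exact: cX.
    - by apply: (cvg_comp _ _ cvg_snd); exact: cX.
    - by apply: (cvg_comp _ _ cvg_fst); exact: cY.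
    - by apply: (cvg_comp _ _ cvg_snd); exact: cY.
  have : \forall p \near (c, c), 0 < phi p.
    by apply: (cvgr_gt _ cphi); rewrite /phi /= -!expr2 XY.
  case/nbhs_ballP => e /= e0 eP.
  (* Half of [e] is spent on the distance from [c] to [a], half on that from [a] to [b]. *)
  have e20 : 0 < e / 2 by exact: divr_gt0.
  near=> a n.
  have ca : `|c - a| < e / 2 by near: a; exact: (nbhsx_ballx c).
  have ne : n.+1%:R^-1 < e / 2.
    by near: n; exact: (near_infty_natSinv_lt (PosNum e20)).
  move=> b abn; apply: (eP (a, b)); split => /=.
    by rewrite /ball /= (lt_trans ca)// gtr_pMr// invf_lt1 ?ltr1n.
  apply: (@le_lt_trans _ _ (`|c - a| + `|a - b|)); first exact: ler_distD.
  by rewrite [ltRHS]splitr ltrD// (le_lt_trans abn).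
move=> n _ nP; exists n => a b a01; apply: nP; rewrite ?in_itv /=.
Unshelve. all: by end_near.
Qed.

(** The retraction of the line onto [0, 1]. Composing with it extends a path on [I01 R] to the whole
    line, where the results of real analysis apply. *)
Definition clampI (R : realType) (t : R) : R := Num.max 0 (Num.min 1 t).

Lemma clampI_in (R : realType) (t : R) : clampI t \in I01 R.
Proof.
apply/mem_set; rewrite /I01 /= in_itv /=.
by rewrite le_max lexx ge_max ler01 ge_min lexx.
Qed.

Definition clamp (R : realType) (t : R) : I01 R :=
  exist _ (clampI t) (clampI_in t).

Lemma I01_itv (R : realType) (t : I01 R) : 0 <= \val t <= 1.
Proof. by have := set_mem (valP t); rewrite /I01 /= in_itv. Qed.

Lemma clampK (R : realType) (t : R) : 0 <= t <= 1 -> \val (clamp t) = t.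
Proof. by case/andP=> t0 t1; rewrite /= /clampI min_r// max_r. Qed.

Lemma clamp_val (R : realType) (t : I01 R) : clamp (\val t) = t.
Proof. by apply: val_inj; rewrite clampK ?I01_itv. Qed.

Lemma continuous_val (T : topologicalType) (A : set T) :
  continuous (fun x : A => \val x : T).
Proof. by move=> x; exact: (@initial_continuous A T set_val). Qed.

Lemma continuous_into (T U : topologicalType) (A : set U) (f : T -> A) :
  continuous (fun x => \val (f x) : U) -> continuous f.
Proof. by move=> cf; exact: (@continuous_comp_initial A T U set_val). Qed.

Lemma continuous_clamp (R : realType) : continuous (@clamp R).
Proof.
apply: continuous_into => t /=.
have c0 : {for t, continuous (cst 0 : R -> R)} by exact: cvg_cst.
have c1 : {for t, continuous (cst 1 : R -> R)} by exact: cvg_cst.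
have ci : {for t, continuous (@id R)} by exact: cvg_id.
exact: (continuous_max c0 (continuous_min c1 ci)).
Qed.

Lemma continuous_S1_cover (R : realType) : continuous (@S1_cover R).
Proof.
apply: continuous_into => t /=.
have ct : continuous (fun t : R => 2 * pi * t) by exact: mulrl_continuous.
apply: (@cvg_pair _ _ _ _ (nbhs (cos (2 * pi * t))) (nbhs (sin (2 * pi * t)))).
  by apply: continuous_comp; [exact: ct|exact: continuous_cos].
by apply: continuous_comp; [exact: ct|exact: continuous_sin].
Qed.

Lemma lift_exists (R : realType) (g : continuousType (I01 R) (S1 R)) :
  exists h : continuousType (I01 R) R,
    @S1_cover R \o h = g /\ 0 <= h (zeroI R) < 1.
Proof.
pose G t := \val (g (clamp t)).
have cG : continuous G.
  move=> t; apply: (@continuous_comp _ _ _ (fun t => g (clamp t))).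
    by apply: continuous_comp; [exact: continuous_clamp|exact: cts_fun].
  exact: continuous_val.
pose X t := (G t).1; pose Y t := (G t).2.
have cX : continuous X by move=> t; apply: cvg_comp; [exact: cG|exact: cvg_fst].
have cY : continuous Y by move=> t; apply: cvg_comp; [exact: cG|exact: cvg_snd].
have XY t : X t ^+ 2 + Y t ^+ 2 = 1 by exact: (set_mem (valP (g (clamp t)))).
have [n nP] := circle_path_subdivision cX cY XY.
have [h0 h001 h0E] := S1_cover_surj (g (zeroI R)).
(* The points [s 0 t = 0], ..., [s n.+1 t = t] cut [0, t] into [n.+1] steps, none longer than the
   mesh that [nP] allows. *)
pose s (i : nat) (t : R) := t * (i%:R / n.+1%:R).
(* [c i t] and [w i t] are the real and imaginary parts of the increment
   G (s i.+1 t) / G (s i t). *)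
pose w i t := Y (s i.+1 t) * X (s i t) - X (s i.+1 t) * Y (s i t).
pose c i t := X (s i t) * X (s i.+1 t) + Y (s i t) * Y (s i.+1 t).
have c_gt0 i (t : I01 R) : (i <= n)%N -> 0 < c i (\val t).
  move=> ile; have /andP[t0 t1] := I01_itv t; apply: nP.
    rewrite /s mulr_ge0 ?divr_ge0 ?ler0n//= mulr_ile1 ?divr_ge0 ?ler0n//.
    by rewrite ler_pdivrMr ?ltr0n// mul1r ler_nat leqW.
  rewrite /s -mulrBr -mulrBl -[i.+1]addn1 natrD opprD addNKr.
  rewrite mulN1r mulrN normrN ger0_norm ?mulr_ge0 ?invr_ge0//.
  by rewrite ler_piMl ?invr_ge0.
(* The modulus is multiplicative, so the increment lies on the unit circle. *)
have cw i t : c i t ^+ 2 + w i t ^+ 2 = 1.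
  have e : c i t ^+ 2 + w i t ^+ 2 =
    (X (s i t) ^+ 2 + Y (s i t) ^+ 2) * (X (s i.+1 t) ^+ 2 + Y (s i.+1 t) ^+ 2).
    by rewrite /c /w; ring.
  by rewrite e !XY mulr1.
(* The bounds are strict because [c i] is positive; strictness keeps [w i] where [asin] is
   continuous. *)
have w_lt1 i (t : I01 R) : (i <= n)%N -> -1 < w i (\val t) < 1.
  move=> /(c_gt0 _ t) c0; rewrite -ltr_norml -(@expr_lt1 _ 2)//.
  have := cw i (\val t); rewrite real_normK ?num_real//.
  have := exprn_gt0 2 c0; lra.
(* The accumulated argument, measured in full turns. *)
pose S k (t : R) := h0 + \sum_(i < k) asin (w i t) / (2 * pi).
have SP k (t : I01 R) : (k <= n.+1)%N ->
    \val (S1_cover (S k (\val t))) = G (s k (\val t)).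
  elim: k => [_|k IH kn]; rewrite /S.
    rewrite big_ord0 addr0 h0E /G /s mul0r mulr0.
    by rewrite -[0]/(\val (zeroI R)) clamp_val.
  have {IH} := IH (ltnW kn); rewrite /S /= big_ord_recr /=.
  set a := h0 + _ => IH.
  have -> : 2 * pi * (h0 + (\sum_(i < k) asin (w i (\val t)) / (2 * pi) +
      asin (w k (\val t)) / (2 * pi))) = 2 * pi * a + asin (w k (\val t)).
    rewrite addrA [LHS]mulrDr [X in _ + X]mulrC divfK//.
    by rewrite mulf_neq0 ?pnatr_eq0// gt_eqF ?pi_gt0.
  have [ca sa] : cos (2 * pi * a) = X (s k (\val t)) /\
                 sin (2 * pi * a) = Y (s k (\val t)).
    by rewrite /X /Y -IH.
  have /andP[/ltW w1 /ltW w2] := w_lt1 _ t kn.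
  have sw : sin (asin (w k (\val t))) = w k (\val t).
    by rewrite asinK// in_itv/= w1 w2.
  have cosw : cos (asin (w k (\val t))) = c k (\val t).
    rewrite cos_asin ?w1 ?w2// -(cw k (\val t)) addrK sqrtr_sqr gtr0_norm//.
    exact: c_gt0.
  rewrite cosD sinD ca sa sw cosw [RHS]surjective_pairing.
  rewrite -/(X (s k.+1 (\val t))) -/(Y (s k.+1 (\val t))); congr pair.
    (* Replacing the factor 1 by [X ^+ 2 + Y ^+ 2] at [s k] leaves a polynomial identity. *)
    rewrite -[RHS]mulr1 -(XY (s k (\val t))) /c /w; ring.
  rewrite -[RHS]mulr1 -(XY (s k (\val t))) /c /w; ring.
have cS : continuous (fun t : I01 R => S n.+1 (\val t)).
  move=> t; have FF : Filter (nbhs t) := @nbhs_filter (set_type (I01 R)) t.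
  apply: cvgD; first exact: cvg_cst.
  apply: cvg_big; first exact: add_continuous.
  move=> i _; apply: cvgMl.
  have cs j : continuous (s j) by move=> u; exact: mulrr_continuous.
  have cwi : continuous (w i).
    move=> u; apply: cvgB; apply: cvgM.
    - by apply: continuous_comp; [exact: cs|exact: cY].
    - by apply: continuous_comp; [exact: cs|exact: cX].
    - by apply: continuous_comp; [exact: cs|exact: cX].
    - by apply: continuous_comp; [exact: cs|exact: cY].
  apply: (@cvg_comp _ _ _ (fun t : I01 R => w i (\val t)) (@asin R));
    last first.
    by apply: continuous_asin; apply: w_lt1; rewrite -ltnS.
  apply: (@continuous_comp _ _ _ (fun t : I01 R => \val t) (w i)).
    exact: continuous_val.
  exact: cwi.
pose h : I01 R -> R := fun t => S n.+1 (\val t).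
pose hc : continuousType (I01 R) R :=
  HB.pack h (@isContinuous.Build _ _ h cS).
exists hc; split.
  apply/funext => t /=; apply: val_inj.
  rewrite SP// /s divff ?pnatr_eq0// mulr1 /G clamp_val//.
(* At 0 all subdivision points coincide, so each increment has argument 0 and the lift starts at
   [h0]. *)
rewrite /hc /= /h /S big1 ?addr0// => i _.
have asin0 : asin 0 = 0 :> R.
  by rewrite -[in LHS]sin0 sinK// in_itv/= oppr_le0 divr_ge0 ?pi_ge0.
have -> : \val (zeroI R) = 0 by [].
by rewrite /w /s !mul0r (mulrC (Y 0)) subrr asin0 mul0r.
Qed.

Lemma lift_unique (R : realType) (h1 h2 : continuousType (I01 R) R) :
  @S1_cover R \o h1 = @S1_cover R \o h2 ->
  0 <= h1 (zeroI R) < 1 -> 0 <= h2 (zeroI R) < 1 -> h1 = h2.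
Proof.
move=> hE h10 h20; apply/continuousEP => t; apply/eqP; rewrite -subr_eq0.
have hint u : h1 u - h2 u \is a Num.int.
  by apply/S1_coverP; exact: (congr1 (@^~ u) hE).
apply: contraT => ht.
pose D s := `|h1 (clamp s) - h2 (clamp s)|.
have cD : continuous D.
  move=> s; apply: cvg_norm; apply: cvgB;
    by apply: continuous_comp; [exact: continuous_clamp|exact: cts_fun].
have D0 : D 0 = 0.
  rewrite /D -[0]/(\val (zeroI R)) clamp_val; apply/eqP; rewrite normr_eq0.
  apply: contraT => /(norm_intr_ge1 (hint (zeroI R))).
  have /andP[? ?] := h10; have /andP[? ?] := h20.
  rewrite leNgt ltr_norml => /negP; case; apply/andP; split; lra.
have D1 : 1 <= D (\val t) by rewrite /D clamp_val; exact: norm_intr_ge1.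
have /andP[t0 _] := I01_itv t.
(* [D] takes only integer values, but passing from 0 to at least 1 it would have to take the value
   1/2. *)
have [||c _ cE] := @IVT R D 0 (\val t) 2^-1 t0.
- exact: continuous_subspaceT.
- by rewrite D0 ge_min le_max; apply/andP; split; apply/orP; [left|right]; lra.
have [z0|] := eqVneq (h1 (clamp c) - h2 (clamp c)) 0.
  by move: cE; rewrite /D z0 normr0; lra.
by move/(norm_intr_ge1 (hint (clamp c))); rewrite -/(D c) cE; lra.
Qed.

(** * The bijection between [C_S1 R] and [Chat R] *)

Lemma continuous_alpha (R : realType) : continuous (@alpha R).
Proof.
move=> t; apply: (@continuous_comp _ _ _ (fun t : I01 R => \val t)
  (@S1_cover R)).
  exact: continuous_val.
exact: continuous_S1_cover.
Qed.

(** By [lift_exists] the set chosen from in [lift_alpha] is inhabited, so [xget] does not fall back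
    on its default. *)
Lemma lift_alphaP (R : realType) (f : C_S1 R) :
  @S1_cover R \o lift_alpha f = f \o @alpha R /\
  0 <= lift_alpha f (zeroI R) < 1.
Proof.
rewrite /lift_alpha; set P := [set h | _]; apply: (@xgetPex _ _ P).
have cfa : continuous (f \o @alpha R).
  by move=> t; apply: continuous_comp; [exact: continuous_alpha|exact: cts_fun].
exact: (lift_exists (HB.pack (f \o @alpha R) (@isContinuous.Build _ _ _ cfa))).
Qed.

Lemma alpha_end (R : realType) : alpha (zeroI R) = alpha (oneI R).
Proof. by apply/S1_coverP; rewrite /= sub0r rpredN rpred1. Qed.

Lemma alpha_surj (R : realType) (x : S1 R) :
  exists2 t : I01 R, \val t < 1 & alpha t = x.
Proof.
have [t /andP[t0 t1] tx] := S1_cover_surj x.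
by exists (clamp t); rewrite /alpha clampK// t0 ltW.
Qed.

Lemma lift_alpha_end (R : realType) (f : C_S1 R) :
  lift_alpha f (oneI R) - lift_alpha f (zeroI R) \is a Num.int.
Proof.
have [E _] := lift_alphaP f.
apply/S1_coverP; rewrite -[LHS]/((@S1_cover R \o lift_alpha f) (oneI R)).
rewrite -[RHS]/((@S1_cover R \o lift_alpha f) (zeroI R)) E /=.
by rewrite alpha_end.
Qed.

Definition lift_Chat (R : realType) (f : C_S1 R) : Chat R :=
  MkChat (lift_alphaP f).2 (lift_alpha_end f).

(** The lift determines [f \o @alpha R], and [alpha] is surjective. *)
Lemma lift_Chat_inj (R : realType) : injective (@lift_Chat R).
Proof.
move=> f g /(congr1 (@Chat_fun R)) /= fg; apply/continuousEP => x.
have [t _ <-] := alpha_surj x.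
have := congr1 (@^~ t) (lift_alphaP f).1; rewrite fg (lift_alphaP g).1.
by [].
Qed.

(** Two points of [0, 1] with integer difference are equal or are the two ends; the bound on [s]
    tells which end is which. *)
Lemma alpha_eq (R : realType) (s t : I01 R) : \val s < 1 -> alpha s = alpha t ->
  s = t \/ s = zeroI R /\ t = oneI R.
Proof.
move=> s1 /S1_coverP st.
have /andP[s0 _] := I01_itv s; have /andP[t0 t1] := I01_itv t.
have [st1|] := leP 1 `|\val s - \val t|; last first.
  have [/eqP|+ lt1] := eqVneq (\val s - \val t) 0.
    by rewrite subr_eq0 => /eqP /val_inj ->; left.
  by move/(norm_intr_ge1 st); rewrite leNgt lt1.
have far_ends (a b : R) : 0 <= a -> a < 1 -> 0 <= b -> b <= 1 ->
    1 <= `|a - b| -> a = 0 /\ b = 1.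
  by move=> ? ? ? ?; rewrite ler_normr => /orP[|] ?; split; lra.
by have [? ?] := far_ends _ _ s0 s1 t0 t1 st1; right; split; apply: val_inj.
Qed.

(** The map is [g \o tau] for an arbitrary section [tau] of [alpha]. Although [tau] need not be
    continuous, the preimage of a closed set under [g \o tau] is the image under [alpha] of a
    compact set, hence closed. *)
Lemma alpha_descend (R : realType) (g : I01 R -> S1 R) :
  continuous g -> g (zeroI R) = g (oneI R) ->
  exists f : C_S1 R, f \o @alpha R = g.
Proof.
move=> cg g01.
have /choice[tau tauP] (x : S1 R) : exists t : I01 R, \val t < 1 /\ alpha t = x.
  by have [t] := alpha_surj x; exists t.
(* [tau (alpha t)] can differ from [t] only by being 0 when [t] is 1, and there [g] takes equal
   values. *)
have fE t : g (tau (alpha t)) = g t.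
  have [t1 /(alpha_eq t1)[->|[-> ->]]//] := tauP (alpha t).
suff cf : continuous (g \o tau).
  exists (HB.pack_for (continuousType (S1 R) (S1 R)) (g \o tau)
    (@isContinuous.Build _ _ _ cf)).
  by apply/funext => t /=; exact: fE.
apply/continuous_closedP => A Acl.
have cgc : continuous (g \o @clamp R).
  by move=> t; apply: continuous_comp; [exact: continuous_clamp|exact: cg].
have cov : continuous (fun t : R => \val (S1_cover t)).
  move=> t; apply: (@continuous_comp _ _ _ (@S1_cover R)).
    exact: continuous_S1_cover.
  exact: continuous_val.
(* [K] is the preimage of [A] under [g], viewed in the line; its image is shown closed in the plane
   and then pulled back to the circle. *)
pose K := `[0, 1]%classic `&` (g \o @clamp R) @^-1` A.
have cK : compact K.
  apply: compact_closedI; first exact: segment_compact.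
  by move/continuous_closedP: cgc; exact.
have clK : closed [set \val (S1_cover t) | t in K].
  apply: compact_closed; first exact: norm_hausdorff.
  by apply: continuous_compact => //; exact: continuous_subspaceT.
have -> : (g \o tau) @^-1` A =
    (fun x : S1 R => \val x) @^-1` [set \val (S1_cover t) | t in K].
  apply/seteqP; split => x /=.
    move=> Ax; exists (\val (tau x)); last exact: (congr1 \val (tauP x).2).
    split; first by rewrite /= in_itv/=; exact: I01_itv.
    by rewrite /preimage /= clamp_val.
  move=> [t [/= + At] tx]; rewrite in_itv/= => t01.
  have {x tx} -> : x = S1_cover t by exact/esym/val_inj.
  have -> : S1_cover t = alpha (clamp t) by rewrite /alpha clampK.
  by rewrite fE.
have /continuous_closedP := @continuous_val _ (S1 R); exact.
Qed.

(** The integer difference at the ends lets [S1_cover \o h] descend to the circle; uniqueness of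
    lifts then identifies [h]. *)
Lemma lift_Chat_surj (R : realType) (h : Chat R) : exists f, lift_Chat f = h.
Proof.
have cg : continuous (@S1_cover R \o h).
  move=> t; apply: continuous_comp; first exact: cts_fun.
  exact: continuous_S1_cover.
have [|f fE] := alpha_descend cg.
  by apply/esym/S1_coverP; exact: Chat_fun1.
exists f; apply: Chat_ext => t /=.
suff -> : lift_alpha f = Chat_fun h by [].
have [E f0] := lift_alphaP f.
by apply: lift_unique => //; [rewrite E fE|exact: Chat_fun0].
Qed.

(** * Comparison of [d0] with [d1] *)

Lemma S1_cover0 (R : realType) : \val (S1_cover 0) = (1, 0) :> R * R.
Proof. by rewrite /= mulr0 cos0 sin0. Qed.

Lemma alpha_neq_base (R : realType) (t : I01 R) :
  \val (alpha t) <> (1, 0) <-> 0 < \val t < 1.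
Proof.
have /andP[t0 t1] := I01_itv t.
rewrite -S1_cover0; split=> [tN|/andP[t0' t1'] /val_inj].
  rewrite !lt_neqAle t0 t1 !andbT; apply/andP; split.
    by apply/eqP => t0E; apply: tN; rewrite /alpha -t0E.
  apply/eqP => t1E; apply: tN; rewrite /alpha t1E.
  by congr \val; apply/S1_coverP; rewrite subr0 rpred1.
move=> /(alpha_eq (s:=t) (t:=zeroI R) t1')[tE|[tE _]];
  by move: t0'; rewrite tE /= ltxx.
Qed.

Lemma alpha_inv_alpha (R : realType) (t : I01 R) :
  0 < \val t < 1 -> alpha_inv (alpha t) = t.
Proof.
move=> t01; apply: xget_unique => //= s [/andP[s0 s1]].
move=> /(alpha_eq s1)[//|[sE _]].
by move: s0; rewrite sE /= ltxx.
Qed.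

(** At each end point, [k] is the one-sided limit of its values inside the interval. *)
Lemma le_itv_closure (R : realType) (k : R -> R) (M : R) : continuous k ->
  (forall t, 0 < t < 1 -> k t <= M) -> forall t, 0 <= t <= 1 -> k t <= M.
Proof.
move=> ck kM t /andP[t0 t1].
have [t0'|t0'] := eqVneq t 0.
  have /cvg_lim <- // := cvg_at_right_filter (ck t).
  apply: limr_le; first by apply/cvg_ex; exists (k t);
    exact: (cvg_at_right_filter (ck t)).
  near=> s; apply: kM; rewrite -t0'; apply/andP; split; near: s.
    exact: nbhs_right_gt.
  by apply: nbhs_right_lt; rewrite t0'.
have [t1'|t1'] := eqVneq t 1.
  have /cvg_lim <- // := cvg_at_left_filter (ck t).
  apply: limr_le; first by apply/cvg_ex; exists (k t);
    exact: (cvg_at_left_filter (ck t)).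
  near=> s; apply: kM; rewrite -t1'; apply/andP; split; near: s.
    by apply: nbhs_left_gt; rewrite t1'.
  exact: nbhs_left_lt.
by apply: kM; rewrite !lt_neqAle t0 t1 eq_sym t0' t1'.
Unshelve. all: by end_near.
Qed.

Lemma d0E (R : realType) (f g : C_S1 R) :
  d0 f g = 2 * pi * d1 (lift_Chat f) (lift_Chat g).
Proof.
congr (_ * _); set S := [set _ | _ in _].
have ubS : ubound S (d1 (lift_Chat f) (lift_Chat g)).
  by move=> _ [x _ <-]; exact: (d1_ge (lift_Chat f) (lift_Chat g)).
have memS t : 0 < \val t < 1 -> S `|lift_alpha f t - lift_alpha g t|.
  move=> t01; exists (alpha t); first exact/alpha_neq_base.
  by rewrite alpha_inv_alpha.
apply/eqP; rewrite eq_le; apply/andP; split.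
  apply: ge_sup => //.
  (* The parameter 1/2 shows that [S] is nonempty, as bounding its supremum from above requires. *)
  have h01 : 0 < (2^-1 : R) < 1 by apply/andP; split; lra.
  exists `|lift_alpha f (clamp 2^-1) - lift_alpha g (clamp 2^-1)|; apply: memS.
  by rewrite clampK//; case/andP: h01 => /ltW -> /ltW ->.
apply: d1_le => t /=.
have := @le_itv_closure R
  (fun s => `|lift_alpha f (clamp s) - lift_alpha g (clamp s)|) (sup S).
move=> /(_ _ _ (\val t) (I01_itv t)); rewrite clamp_val; apply.
  move=> s; apply: cvg_norm; apply: cvgB;
    by apply: continuous_comp; [exact: continuous_clamp|exact: cts_fun].
move=> s s01; apply: ub_le_sup.
  by exists (d1 (lift_Chat f) (lift_Chat g)).
by apply: memS; rewrite clampK//; case/andP: s01 => /ltW -> /ltW ->.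
Qed.

Lemma d0_metric (R : realType) : is_metric (@d0 R).
Proof.
have [d1ge0 d1eq0 d1C d1D] := d1_metric R.
have pi2 : 0 < 2 * pi :> R by rewrite mulr_gt0// pi_gt0.
split=> [f g|f g|f g|f g h]; rewrite !d0E.
- by rewrite mulr_ge0// ltW.
- split=> [/eqP|->]; last by rewrite (d1eq0 _ _).2 ?mulr0.
  by rewrite mulf_eq0 gt_eqF//= => /eqP /d1eq0 /lift_Chat_inj.
- by rewrite d1C.
- by rewrite -mulrDr ler_pM2l.
Qed.

(** * Passage from the metrics to the homeomorphism *)

Lemma lipschitz_continuous (R : realType) (T U : choiceType) (d : T -> T -> R)
    (e : U -> U -> R) (hd : is_metric d) (he : is_metric e) (k : R)
    (phi : metric_space hd -> metric_space he) : 0 < k ->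
  (forall x y, e (phi x) (phi y) <= k * d x y) -> continuous phi.
Proof.
move=> k0 phik x A /nbhs_ballP[r /= r0 rA].
apply/nbhs_ballP; exists (r / k); first exact: divr_gt0.
move=> y; rewrite ballEmdist /= => xy; apply: rA; rewrite ballEmdist /=.
by apply: le_lt_trans (phik x y) _; rewrite mulrC -ltr_pdivlMr.
Qed.

Unset Implicit Arguments.

Theorem proposition3p1 (R : realType) :
  exists (hd0 : is_metric (@d0 R)),
  exists (phi : metric_space hd0 -> metric_space (d1_metric R)),
    homeomorphism phi /\
    forall f g : C_S1 R, d0 f g = 2 * pi * d1 (phi f) (phi g).
Proof.
exists (d0_metric R), (@lift_Chat R); split; last exact: d0E.
have pi2 : 0 < 2 * pi :> R by rewrite mulr_gt0// pi_gt0.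
have /choice[psi psiK] := @lift_Chat_surj R.
split.
  apply: (@lipschitz_continuous _ _ _ _ _ _ _ (2 * pi)^-1).
    by rewrite invr_gt0.
  by move=> f g; rewrite d0E mulKf// gt_eqF.
(* Choice makes [psi] a right inverse of [lift_Chat]; injectivity makes it a left inverse too. *)
exists psi; split=> //; last by move=> f; apply: lift_Chat_inj; rewrite psiK.
apply: (@lipschitz_continuous _ _ _ _ _ _ _ (2 * pi)) => // h k.
by rewrite d0E !psiK.
Qed.
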